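(* Let $r,s\in C^1[0,\infty)$ and $u\in C[0,\infty)$ be real-valued functions satisfying $$\dot s(t)=2u(t)r(t),\qquad \dot r(t)=-2u(t)s(t),$$ with $\operatorname{sgn}(u(t))=\operatorname{sgn}(r(t))$ for all $t>0$, and with $r(t)>0$, $s(t)>0$ for all $t\ge 0$. Put $C=\sqrt{s(t)^2+r(t)^2}$ (which is independent of $t$) and $p(t)=\frac12+\frac{s(t)}{2C}$. Let $j\in\frac12\mathbb N$ and define, for $x\in\{0,\dots,2j\}$, $$W_t(x)=\binom{2j}{x}p(t)^x(1-p(t))^{2j-x}.$$ For $t>0$ let $U_t:\ell^2_j\to \ell^2(\{0,\dots,2j\},W_t)$ be the linear map defined by $[U_te_n](x)=K_n(x;p(t),2j)$, $n=0,\dots,2j$. Then $U_t$ is unitary and $$U_t\circ \pi_j(L(t))\circ U_t^*=M(2C(j-x)).$$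
   Context: $\mathbb N=\{0,1,2,\dots\}$. The Lie algebra considered has basis $H,E,F$ with $[H,E]=2E$, $[H,F]=-2F$, $[E,F]=H$, and $*$-structure $H^*=H$, $E^*=F$ (i.e. $\mathfrak{su}(2)$). The Lax operator is $L(t)=s(t)H+r(t)(E+F)$ (with partner $M(t)=u(t)(E-F)$; the differential equations above are the equations $\dot L=[M,L]$). $\ell^2_j$ is the $(2j+1)$-dimensional complex Hilbert space with orthonormal basis $e_0,\dots,e_{2j}$. The representation $\pi_j$ on $\ell^2_j$ is given by $\pi_j(H)e_n=2(n-j)e_n$, $\pi_j(E)e_n=\sqrt{(n+1)(2j-n)}\,e_{n+1}$, $\pi_j(F)e_n=\sqrt{n(2j-n+1)}\,e_{n-1}$, with $e_{-1}=e_{2j+1}=0$. Hence $$\pi_j(L(t))e_n=r(t)\sqrt{(n+1)(2j-n)}\,e_{n+1}+2s(t)(n-j)e_n+r(t)\sqrt{n(2j-n+1)}\,e_{n-1}.$$ Orthonormal Krawtchouk polynomials: for $N\in\mathbb N$, $0<p<1$, $n,x\in\{0,\dots,N\}$, $$K_n(x;p,N)=\Big(\frac{p}{1-p}\Big)^{n/2}\sqrt{\binom Nn}\;{}_2F_1\Big({-n,-x\atop -N};\frac1p\Big),$$ the ${}_2F_1$ being the terminating sum up to $\min(n,x)$. $\ell^2(X,W)$ is the weighted space with inner product $\sum_{x\in X}f(x)\overline{g(x)}W(x)$. $M(f)$ denotes the multiplication operator $[M(f)g](x)=f(x)g(x)$ (not to be confused with the Lax partner $M(t)$). *)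

(* Defs.v *)
From HB Require Import structures.
From mathcomp Require Import all_boot all_order all_algebra.
From mathcomp Require Import complex.
From mathcomp Require Import all_classical all_reals all_analysis.
Set Implicit Arguments.
Unset Strict Implicit.
Unset Printing Implicit Defensive.
Import Order.TTheory GRing.Theory Num.Theory.
Import numFieldNormedType.Exports.
Local Open Scope classical_set_scope.
Local Open Scope complex_scope.
Local Open Scope ring_scope.

Section HalfLine.
Variable R : realType.
Implicit Types (f : R -> R) (t l : R).

Definition halfline : set R := `[0, +oo[.

Definition continuous_halfline f := {within halfline, continuous f}.

(* Derivative relative to [0, +oo[: two-sided for t > 0, one-sided for t = 0. *)
Definition is_deriv_halfline f t l :=
  (f x - f t) / (x - t) @[x --> within halfline t^'] --> l.

Definition C1_halfline f := exists2 f' : R -> R,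
  forall t, 0 <= t -> is_deriv_halfline f t (f' t) & continuous_halfline f'.

End HalfLine.

Section Operators.
Variable R : realType.
Local Notation C := R[i].

(* ell^2(X, W), for a finite set X, is carried by {ffun X -> C}. *)
Definition wdot (X : finType) (W : X -> R) (f g : {ffun X -> C}) : C :=
  \sum_x f x * (g x)^* * (W x)%:C.

Definition adjoint_map (X Y : finType) (V : X -> R) (W : Y -> R)
    (U : {ffun X -> C} -> {ffun Y -> C}) (Us : {ffun Y -> C} -> {ffun X -> C}) :=
  forall f g, wdot W (U f) g = wdot V f (Us g).

Definition unitary_map (X Y : finType) (V : X -> R) (W : Y -> R)
    (U : {ffun X -> C} -> {ffun Y -> C}) :=
  [/\ linear U, bijective U & forall f g, wdot W (U f) (U g) = wdot V f g].

Definition mulop (X : finType) (h : X -> R) (g : {ffun X -> C}) : {ffun X -> C} :=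
  [ffun x => (h x)%:C * g x].

(* The space ell^2_j with N = 2j; its weight is constantly 1. *)
Definition ell2 (N : nat) := {ffun 'I_N.+1 -> C}.

Definition unit_weight (N : nat) (n : 'I_N.+1) : R := 1.

(* e_k for k <= N, and 0 for k > N. *)
Definition basis_vec (N k : nat) : ell2 N := [ffun i : 'I_N.+1 => (i == k :> nat)%:R].

(* The linear map sending e_n to a n. *)
Definition lin_ext (N : nat) (V : lmodType C) (a : 'I_N.+1 -> V) (v : ell2 N) : V :=
  \sum_n v n *: a n.

Lemma lin_ext_basis (N : nat) (V : lmodType C) (a : 'I_N.+1 -> V) (n : 'I_N.+1) :
  lin_ext a (basis_vec N n) = a n.
Proof.
rewrite /lin_ext (bigD1 n) //= ffunE eqxx scale1r big1 ?addr0 // => i /negPf ne.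
by rewrite ffunE -[(_ == _ :> nat)]/(i == n) ne scale0r.
Qed.

Lemma lin_ext_is_linear (N : nat) (V : lmodType C) (a : 'I_N.+1 -> V) :
  linear (lin_ext a).
Proof.
move=> k u v; rewrite /lin_ext scaler_sumr -big_split /=; apply: eq_bigr => n _.
by rewrite !ffunE scalerDl scalerA.
Qed.

Lemma adjoint_unique (N : nat) (Y : finType) (W : Y -> R)
    (U : ell2 N -> {ffun Y -> C}) (Us Us' : {ffun Y -> C} -> ell2 N) :
  adjoint_map (@unit_weight N) W U Us -> adjoint_map (@unit_weight N) W U Us' ->
  Us = Us'.
Proof.
have dotE g (n : 'I_N.+1) : wdot (@unit_weight N) (basis_vec N n) g = (g n)^*.
  rewrite /wdot (bigD1 n) //= ffunE eqxx mul1r mulr1 big1 ?addr0 // => i /negPf ne.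
  by rewrite ffunE -[(_ == _ :> nat)]/(i == n) ne !mul0r.
move=> h h'; apply/funext => g; apply/ffunP => n.
by apply: (inv_inj (@conjCK _)); rewrite -!dotE -h h'.
Qed.

(* The Lie algebra: traceless complex 2 x 2 matrices, with the commutator as
   bracket and the conjugate transpose as *-structure. *)
Definition sl2H : 'M[C]_2 := delta_mx 0 0 - delta_mx 1 1.
Definition sl2E : 'M[C]_2 := delta_mx 0 1.
Definition sl2F : 'M[C]_2 := delta_mx 1 0.

Lemma sl2_brackets :
  [/\ sl2H *m sl2E - sl2E *m sl2H = 2 *: sl2E,
      sl2H *m sl2F - sl2F *m sl2H = - 2 *: sl2F &
      sl2E *m sl2F - sl2F *m sl2E = sl2H].
Proof.
rewrite /sl2H /sl2E /sl2F !mulmxBl !mulmxBr !mul_delta_mx_cond /= !mulr0n !mulr1n.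
rewrite !sub0r !subr0 !opprK.
by split=> //; rewrite ?scaleNr scaler_nat mulr2n // opprD.
Qed.

Definition laxL (s r : R -> R) (t : R) : 'M[C]_2 :=
  (s t)%:C *: sl2H + (r t)%:C *: (sl2E + sl2F).

Definition spin (N : nat) : R := N%:R / 2.

Section Representation.
Variable N : nat.
Local Notation j := (spin N).

Definition piH : ell2 N -> ell2 N :=
  lin_ext (fun n : 'I_N.+1 => (2 * (n%:R - j))%:C *: basis_vec N n).

Definition piE : ell2 N -> ell2 N :=
  lin_ext (fun n : 'I_N.+1 =>
    (Num.sqrt (n.+1%:R * (2 * j - n%:R)))%:C *: basis_vec N n.+1).

(* For n = 0 the coefficient vanishes, so e_{-1} is immaterial. *)
Definition piF : ell2 N -> ell2 N :=
  lin_ext (fun n : 'I_N.+1 =>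
    (Num.sqrt (n%:R * (2 * j - n%:R + 1)))%:C *: basis_vec N n.-1).

(* A traceless X is X00 H + X01 E + X10 F. *)
Definition pi_rep (X : 'M[C]_2) (v : ell2 N) : ell2 N :=
  X 0 0 *: piH v + X 0 1 *: piE v + X 1 0 *: piF v.

End Representation.

End Operators.

Section Krawtchouk.
Variable R : realType.
Implicit Types (a b c z p : R) (n x k N : nat).

(* Rising factorial (a)_k. *)
Definition poch a k : R := \prod_(i < k) (a + i%:R).

(* The partial sum, up to index m, of the series 2F1(a, b; c; z). *)
Definition hyp2F1_trunc m a b c z : R :=
  \sum_(k < m.+1) poch a k * poch b k / poch c k / k`!%:R * z ^+ k.

Definition krawtchouk n p N x : R :=
  (p / (1 - p)) `^ (n%:R / 2) * Num.sqrt 'C(N, n)%:R *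
  hyp2F1_trunc (minn n x) (- n%:R) (- x%:R) (- N%:R) p^-1.

Definition krawtchouk_weight p N x : R :=
  'C(N, x)%:R * p ^+ x * (1 - p) ^+ (N - x).

Definition krawtchouk_map N p : ell2 R N -> {ffun 'I_N.+1 -> R[i]} :=
  lin_ext (fun n : 'I_N.+1 => [ffun x : 'I_N.+1 => (krawtchouk n p N x)%:C]).

End Krawtchouk.

(* Main.v *)
(** Along the flow, s^2 + r^2 has derivative 4usr - 4usr = 0, which gives C; then
    s = C(2p - 1) and r = 2C sqrt(p(1 - p)).  For fixed x, the numbers
    binom(N, n) 2F1(-n, -x; -N; 1/p) are the coefficients of the polynomial
      P_x(X) = (1 + X)^(N - x) (1 - c X)^x,   c = (1 - p)/p.
    The linear differential equation of order one satisfied by P_x is the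
    three-term recurrence in n, which says that U intertwines pi(L) with the
    multiplication by 2C(j - x).  By the binomial theorem
      sum_x W(x) P_x(X) P_x(Y) = (1 + c X Y)^N,
    which is the orthogonality of the Krawtchouk polynomials, i.e. U* U = 1;
    since U is given by a square matrix, also U U* = 1. *)
Require Import Defs.
From HB Require Import structures.
From mathcomp Require Import all_boot all_order all_algebra.
From mathcomp Require Import complex.
From mathcomp Require Import all_classical all_reals all_analysis.
From mathcomp Require Import ring lra zify.
Set Implicit Arguments.
Unset Strict Implicit.
Unset Printing Implicit Defensive.
Import Order.TTheory GRing.Theory Num.Theory.
Import numFieldNormedType.Exports.
Local Open Scope ring_scope.

(** * The generating polynomials P_x: coefficients, differential equation, orthogonality *)

Lemma coef_exp1DX (F : nzSemiRingType) m k :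
  ((1 + 'X : {poly F}) ^+ m)`_k = 'C(m, k)%:R.
Proof.
rewrite exprDn_comm; last exact/commr_sym/commr1.
under eq_bigr => i _ do rewrite expr1n mul1r.
rewrite coef_sum; under eq_bigr => i _ do rewrite coefMn coefXn.
case: (ltnP k m.+1) => km.
  rewrite (bigD1 (Ordinal km)) //= eqxx big1 ?addr0 // => i /eqP ne.
  by case: eqP => [e|_]; [case: ne; apply: val_inj | rewrite mul0rn].
rewrite bin_small // big1 // => i _; case: eqP => [e|_]; last by rewrite mul0rn.
by move: (ltn_ord i); rewrite -e ltnNge km.
Qed.

Definition krawtchouk_poly (F : nzRingType) (c : F) N x : {poly F} :=
  (1 + 'X) ^+ (N - x) * (1 - c *: 'X) ^+ x.

(** Write 1 - cX = (1 + X) - (1 + c)X and expand its x-th power: the k-th term becomes a multiple of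
    X^k (1 + X)^(N - k). This choice makes the coefficients match the 2F1 series term by term. *)
Lemma coef_krawtchouk_poly (F : comNzRingType) (c : F) N x n : (x <= N)%N ->
  (krawtchouk_poly c N x)`_n =
  \sum_(k < x.+1 | (k <= n)%N)
    (- (1 + c)) ^+ k * ('C(x, k) * 'C(N - k, n - k))%:R.
Proof.
move=> xN; rewrite /krawtchouk_poly.
have -> : 1 - c *: 'X = (1 + 'X) + (- (1 + c)) *: 'X :> {poly F}.
  by rewrite scaleNr scalerDl scale1r opprD addrA addrK.
rewrite [X in _ * X]exprDn mulr_sumr coef_sum [RHS]big_mkcond; apply: eq_bigr => k _.
have kx : (k <= x)%N by rewrite -ltnS.
rewrite [in LHS]mulrnAr mulrA -exprD exprZn -scalerAr coefMn coefZ coefMXn.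
rewrite (_ : N - x + (x - k) = N - k)%N; last by lia.
rewrite coef_exp1DX ltnNge; case: (k <= n)%N => /=; last by rewrite mulr0 mul0rn.
by rewrite -mulrnAr -mulr_natl -natrM.
Qed.

(** This is the logarithmic derivative of P_x with denominators cleared, hence valid over any
    commutative ring. *)
Lemma krawtchouk_poly_deriv (F : comNzRingType) (c : F) N x : (x <= N)%N ->
  (1 + 'X) * (1 - c *: 'X) * (krawtchouk_poly c N x)^`() =
  ((N - x)%:R *: (1 - c *: 'X) - (c * x%:R) *: (1 + 'X)) * krawtchouk_poly c N x.
Proof.
(* At m = 0 the truncated exponent [m.-1] is harmless, because the factor m vanishes. *)
have expS (a : {poly F}) m : a * (a ^+ m.-1 *+ m) = m%:R *: a ^+ m.
  by case: m => [|m]; rewrite ?mulr0n ?mulr0 ?scale0r // mulrnAr -exprS scaler_nat.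
move=> xN; rewrite /krawtchouk_poly derivM !deriv_exp.
rewrite derivD derivB (derivC 1) derivZ derivX sub0r add0r mul1r.
set a := 1 + 'X; set b := 1 - c *: 'X.
transitivity (b * (a * (a ^+ (N - x).-1 *+ (N - x))) * b ^+ x -
              c *: a * (b * (b ^+ x.-1 *+ x)) * a ^+ (N - x)).
  by rewrite -!mul_polyC; ring.
by rewrite !expS -!mul_polyC; ring.
Qed.

(** The binomial sum has base (1 - p)(1 + X)(1 + Y) + p(1 - cX)(1 - cY), which collapses to 1 + cXY
    because p(1 + c) = 1; its N-th power has only diagonal terms X^i Y^i. *)
Lemma krawtchouk_poly_orthogonal (F : comNzRingType) (p c : F) N n m :
    p * (1 + c) = 1 ->
  \sum_(x < N.+1) 'C(N, x)%:R * p ^+ x * (1 - p) ^+ (N - x) *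
    ((krawtchouk_poly c N x)`_n * (krawtchouk_poly c N x)`_m) =
  (n == m)%:R * (c ^+ n * 'C(N, n)%:R).
Proof.
move=> pc.
(* In [{poly {poly F}}] the outer variable X carries the index n and the inner variable Y the index
   m. *)
have Pxy x : map_poly polyC (krawtchouk_poly c N x) * (krawtchouk_poly c N x)%:P =
    ((1 + 'X) * (1 + 'X)%:P) ^+ (N - x) *
    ((1 - c%:P *: 'X) * (1 - c *: 'X)%:P) ^+ x.
  rewrite /krawtchouk_poly !rmorphM !rmorphXn /= rmorphD rmorphB /= rmorph1.
  by rewrite map_polyZ map_polyX !exprMn; ring.
have key : \sum_(x < N.+1) ('C(N, x)%:R * p ^+ x * (1 - p) ^+ (N - x))%:P *:
    (map_poly polyC (krawtchouk_poly c N x) * (krawtchouk_poly c N x)%:P) =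
    (1 + (c *: 'X)%:P * 'X) ^+ N :> {poly {poly F}}.
  rewrite (_ : 1 + _ = (1 - p)%:P%:P * ((1 + 'X) * (1 + 'X)%:P) +
     p%:P%:P * ((1 - c%:P *: 'X) * (1 - c *: 'X)%:P)).
    rewrite exprDn; apply: eq_bigr => x _.
    rewrite Pxy -mul_polyC !polyCM !polyC_exp !polyC_natr !exprMn.
    by rewrite -mulr_natl; ring.
  rewrite -!mul_polyC !(rmorphB, rmorphD, rmorphM, rmorph1) /=.
  have := congr1 (fun z => z%:P%:P : {poly {poly F}}) pc.
  rewrite !(rmorphB, rmorphD, rmorphM, rmorph1) /=.
  rewrite mulrDr mulr1 => PC; set rhs := RHS.
  have -> : rhs = 1 + (1 - (p%:P%:P + p%:P%:P * c%:P%:P)) *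
      ('X%:P + 'X + 'X%:P * 'X) +
      (p%:P%:P + p%:P%:P * c%:P%:P) * c%:P%:P * 'X%:P * 'X.
    by rewrite /rhs; ring.
  by rewrite PC subrr mul0r addr0 mul1r.
transitivity ((\sum_(x < N.+1) ('C(N, x)%:R * p ^+ x * (1 - p) ^+ (N - x))%:P *:
    (map_poly polyC (krawtchouk_poly c N x) *
     (krawtchouk_poly c N x)%:P))`_n`_m).
  rewrite !coef_sum; apply: eq_bigr => x _.
  by rewrite coefZ coefMC coef_map !coefCM.
have coefi i : ((1 ^+ (N - i) * ((c *: 'X)%:P * 'X) ^+ i : {poly {poly F}}) *+
    'C(N, i))`_n`_m = ((n == i) && (m == i))%:R * (c ^+ i * 'C(N, i)%:R).
  rewrite expr1n mul1r exprMn -polyC_exp exprZn coefMn coefCM coefXn coefMn.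
  case: (n == i); last by rewrite mulr0 coef0 mul0rn mul0r.
  by rewrite mulr1 coefZ coefXn /= -mulr_natr; ring.
rewrite key exprDn !coef_sum.
under eq_bigr => i _ do rewrite coefi.
case: (ltnP n N.+1) => nN; last first.
  rewrite bin_small // !mulr0 big1 // => i _.
  by rewrite gtn_eqF ?mul0r // (leq_trans (ltn_ord i)).
rewrite (bigD1 (Ordinal nN)) //= eqxx big1 ?addr0 /= 1?eq_sym // => i ne.
case: eqP => [e|]; last by rewrite mul0r.
by case/eqP: ne; apply: val_inj.
Qed.

(** Compare the coefficients of X^n in the differential equation; the [if] stands for a zero
    coefficient of index -1. *)
Lemma krawtchouk_poly_recurrence (F : comNzRingType) (c : F) N x n :
    (x <= N)%N -> (n <= N)%N ->
  n.+1%:R * (krawtchouk_poly c N x)`_n.+1 +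
    (if n is n'.+1 then c * (N - n')%:R * (krawtchouk_poly c N x)`_n' else 0) =
  (N%:R - (1 + c) * x%:R - (1 - c) * n%:R) * (krawtchouk_poly c N x)`_n.
Proof.
move=> xN nN.
have := congr1 (fun P : {poly F} => P`_n) (krawtchouk_poly_deriv c xN).
set P := krawtchouk_poly c N x.
have -> : (1 + 'X) * (1 - c *: 'X) * P^`() =
  P^`() + (1 - c) *: ('X * P^`()) - c *: ('X * ('X * P^`())).
  by rewrite -!mul_polyC; ring.
have -> : ((N - x)%:R *: (1 - c *: 'X) - (c * x%:R) *: (1 + 'X)) * P =
  ((N - x)%:R - c * x%:R) *: P - (c * N%:R) *: ('X * P).
  by rewrite natrB // -!mul_polyC; ring.
rewrite !(coefB, coefD, coefZ, coefXM) !coef_deriv natrB //.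
move/eqP; rewrite -subr_eq0 => /eqP H; apply: subr0_eq; rewrite -[RHS]H.
(* The term X^2 P' reaches back two places, so n = 0 and n = 1 are treated apart. *)
by case: n nN {H} => [|[|n]] nN /=; rewrite ?natrB ?(ltnW nN) //; ring.
Qed.

(** * From the hypergeometric series to the coefficients of P_x *)

Lemma poch_oppn (R : realType) m k :
  poch (- m%:R : R) k = (-1) ^+ k * (m ^_ k)%:R.
Proof.
elim: k => [|k IH]; first by rewrite /poch big_ord0 expr0 ffactn0 mul1r.
rewrite /poch big_ord_recr /= -/(poch _ k) IH ffactnSr.
case: (leqP k m) => km; last by rewrite ffact_small // mul0n !mulr0 mul0r.
by rewrite natrM natrB // exprS; ring.
Qed.

(** Multiplied by (n - k)! (N - n)!, both sides become N!. *)
Lemma bin_mul_ffact N n k : (k <= n <= N)%N ->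
  ('C(N, n) * n ^_ k = N ^_ k * 'C(N - k, n - k))%N.
Proof.
case/andP=> kn nN; have kN := leq_trans kn nN.
have pos : (0 < (n - k)`! * (N - n)`!)%N by rewrite muln_gt0 !fact_gt0.
apply/eqP; rewrite -(eqn_pmul2r pos) -mulnA [(n ^_ k * _)%N]mulnA ffact_fact //.
rewrite bin_fact // -mulnA.
rewrite (_ : (N - n)`! = (N - k - (n - k))`!)%N; last by congr (_`!); lia.
by rewrite bin_fact ?leq_sub2r // ffact_fact.
Qed.

(** With c = (1 - p)/p one has 1 + c = 1/p, and the sums agree term by term: x^_k / k! is a binomial
    coefficient, and the factor binom(N, n) absorbs n^_k / N^_k. The denominators are nonzero since
    k <= n <= N. *)
Lemma hyp2F1_krawtchouk (R : realType) (p : R) N n x :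
    p != 0 -> (n <= N)%N -> (x <= N)%N ->
  'C(N, n)%:R *
    hyp2F1_trunc (minn n x) (- n%:R) (- x%:R) (- N%:R) p^-1 =
  (krawtchouk_poly ((1 - p) / p) N x)`_n.
Proof.
move=> p0 nN xN; rewrite coef_krawtchouk_poly // /hyp2F1_trunc.
have -> : - (1 + (1 - p) / p) = - p^-1 :> R by field.
(* The bound min(n, x) is traded for the bound x with the side condition k <= n. *)
rewrite (big_ord_widen x.+1 (fun k => poch (- n%:R) k * poch (- x%:R) k /
  poch (- N%:R) k / k`!%:R * p^-1 ^+ k)) ?ltnS ?geq_minr // mulr_sumr.
apply: eq_big => [k|k kn].
  by rewrite ltnS leq_min -(ltnS k x) ltn_ord andbT.
have {}kn : (k <= n)%N by rewrite ltnS leq_min in kn; case/andP: kn.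
have NkE : ((N ^_ k)%:R : R) != 0.
  by rewrite pnatr_eq0 -lt0n ffact_gt0 (leq_trans kn).
have xE : (x ^_ k)%:R = 'C(x, k)%:R * k`!%:R :> R by rewrite -natrM bin_ffact.
have nE : 'C(N, n)%:R * (n ^_ k)%:R = (N ^_ k)%:R * 'C(N - k, n - k)%:R :> R.
  by rewrite -!natrM bin_mul_ffact // kn.
have kE : k`!%:R != 0 :> R by rewrite pnatr_eq0 -lt0n fact_gt0.
have sE : (-1) ^+ k != 0 :> R by rewrite signr_eq0.
rewrite !poch_oppn xE natrM [(- p^-1) ^+ k]exprNn.
transitivity ((-1) ^+ k * p^-1 ^+ k * 'C(x, k)%:R *
  ('C(N, n)%:R * (n ^_ k)%:R) / (N ^_ k)%:R :> R).
  by field; rewrite NkE kE sE.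
by rewrite nE; field.
Qed.

(** The coefficient of P_x already contains binom(N, n), so the normalising root moves to the
    denominator. *)
Lemma krawtchoukE (R : realType) (p : R) N n x :
    0 < p < 1 -> (n <= N)%N -> (x <= N)%N ->
  krawtchouk n p N x = Num.sqrt (p / (1 - p)) ^+ n / Num.sqrt 'C(N, n)%:R *
    (krawtchouk_poly ((1 - p) / p) N x)`_n.
Proof.
case/andP=> p0 p1 nN xN.
have C0 : 0 < 'C(N, n)%:R :> R by rewrite ltr0n bin_gt0.
have sC0 : Num.sqrt 'C(N, n)%:R != 0 :> R by rewrite gt_eqF ?sqrtr_gt0.
rewrite /krawtchouk -hyp2F1_krawtchouk ?gt_eqF // mulrC [n%:R / 2]mulrC powRrM.
rewrite powR12_sqrt ?divr_ge0 ?subr_ge0 ?ltW // powR_mulrn ?sqrtr_ge0 //.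
by rewrite -{3}(sqr_sqrtr (ltW C0)); field.
Qed.

(** * Orthonormality and recurrence for the normalised polynomials *)

Lemma krawtchouk_orthonormal (R : realType) (p : R) N n m :
    0 < p < 1 -> (n <= N)%N -> (m <= N)%N ->
  \sum_(x < N.+1)
    krawtchouk n p N x * krawtchouk m p N x * krawtchouk_weight p N x =
  (n == m)%:R.
Proof.
move=> p01 nN mN; have [p0 p1] := andP p01.
have pc : p * (1 + (1 - p) / p) = 1 by field; rewrite gt_eqF.
set rho := Num.sqrt (p / (1 - p)).
transitivity (rho ^+ n / Num.sqrt 'C(N, n)%:R * (rho ^+ m / Num.sqrt 'C(N, m)%:R)
   * \sum_(x < N.+1) 'C(N, x)%:R * p ^+ x * (1 - p) ^+ (N - x) *
    ((krawtchouk_poly ((1 - p) / p) N x)`_n *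
     (krawtchouk_poly ((1 - p) / p) N x)`_m)).
  rewrite mulr_sumr; apply: eq_bigr => x _.
  have xN : (x <= N)%N by rewrite -ltnS.
  rewrite (krawtchoukE p01 nN xN) (krawtchoukE p01 mN xN).
  rewrite -/(krawtchouk_weight p N x) -/rho.
  rewrite [X in X * _ = _]mulrACA -[LHS]mulrA; congr (_ * _). by rewrite mulrC.
rewrite krawtchouk_poly_orthogonal //.
case: eqP => [<-|_]; last by rewrite mul0r mulr0.
have C0 : 0 < 'C(N, n)%:R :> R by rewrite ltr0n bin_gt0.
have sC0 : Num.sqrt 'C(N, n)%:R != 0 :> R by rewrite gt_eqF ?sqrtr_gt0.
rewrite -{3}(sqr_sqrtr (ltW C0)).
(* The squared norm is (rho^2 c)^n, and rho^2 = p/(1 - p) is the inverse of c. *)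
transitivity ((rho ^+ 2 * ((1 - p) / p)) ^+ n).
  by rewrite [RHS]exprMn -exprM mulnC exprM mulr1n; field.
rewrite sqr_sqrtr ?divr_ge0 ?subr_ge0 ?ltW //.
rewrite (_ : _ * _ = 1) ?expr1n //; field.
by rewrite subr_eq0 !gt_eqF.
Qed.

(** Both follow from (n + 1) binom(N, n + 1) = (N - n) binom(N, n) under the root. They turn the
    matrix entries of E and F into integer factors once the normalisation of K_n is taken into
    account. *)
Lemma sqrt_bin_left (R : rcfType) N n : (n < N)%N ->
  Num.sqrt (n.+1%:R * (N%:R - n%:R)) * Num.sqrt 'C(N, n)%:R =
    n.+1%:R * Num.sqrt 'C(N, n.+1)%:R :> R /\
  Num.sqrt (n.+1%:R * (N%:R - n%:R)) * Num.sqrt 'C(N, n.+1)%:R =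
    (N - n)%:R * Num.sqrt 'C(N, n)%:R :> R.
Proof.
move=> nN.
have e : n.+1%:R * 'C(N, n.+1)%:R = (N - n)%:R * 'C(N, n)%:R :> R.
  by rewrite -!natrM mul_bin_left.
have sqE a b : Num.sqrt (a%:R ^+ 2 * b%:R) = a%:R * Num.sqrt b%:R :> R.
  by rewrite sqrtrM ?sqr_ge0 // sqrtr_sqr normr_nat.
rewrite -natrB ?(ltnW nN) // -!sqrtrM ?mulr_ge0 // -!sqE.
by split; congr Num.sqrt; [rewrite expr2 -!mulrA e | rewrite mulrAC e]; ring.
Qed.

(** This is the recurrence for the coefficients of P_x, multiplied by p and by the normalising
    factor [k] of K_n. *)
Lemma krawtchouk_recurrence (R : realType) (p : R) N n x :
    0 < p < 1 -> (n <= N)%N -> (x <= N)%N ->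
  Num.sqrt (p * (1 - p)) *
    (Num.sqrt (n.+1%:R * (N%:R - n%:R)) * krawtchouk n.+1 p N x +
     Num.sqrt (n%:R * (N%:R - n%:R + 1)) * krawtchouk n.-1 p N x) =
  (p * N%:R - x%:R - (2 * p - 1) * n%:R) * krawtchouk n p N x.
Proof.
move=> p01 nN xN; have [p0 p1] := andP p01.
have q0 : 0 < 1 - p by rewrite subr_gt0.
set P := krawtchouk_poly ((1 - p) / p) N x.
pose k := Num.sqrt (p / (1 - p)) ^+ n / Num.sqrt 'C(N, n)%:R.
have sC0 k' : (k' <= N)%N -> Num.sqrt 'C(N, k')%:R != 0 :> R.
  by move=> ?; rewrite gt_eqF // sqrtr_gt0 ltr0n bin_gt0.
set rho := Num.sqrt (p / (1 - p)) in k *.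
have rho2 : rho ^+ 2 = p / (1 - p) by rewrite sqr_sqrtr // divr_ge0 ?ltW.
have -> : Num.sqrt (p * (1 - p)) = (1 - p) * rho.
  have -> : p * (1 - p) = (1 - p) ^+ 2 * (p / (1 - p)) by field; rewrite gt_eqF.
  by rewrite sqrtrM ?sqr_ge0 // sqrtr_sqr gtr0_norm.
have up : Num.sqrt (n.+1%:R * (N%:R - n%:R)) * krawtchouk n.+1 p N x =
    k * rho * (n.+1%:R * P`_n.+1).
  (* At n = N the root on the left vanishes, and so does the coefficient of index N + 1, since P_x
     has degree at most N. *)
  move: (nN); rewrite leq_eqVlt => /predU1P[eN|ltnN].
    rewrite eN subrr mulr0 sqrtr0 mul0r coef_krawtchouk_poly //.
    rewrite big1 ?mulr0 // => i _.
    by rewrite [X in (_ * X)%N]bin_small ?muln0 ?mulr0 //; have := ltn_ord i; lia.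
  have [/(canRL (mulfK (sC0 _ nN))) -> _] := sqrt_bin_left R ltnN.
  rewrite krawtchoukE // -/rho -/P /k exprS.
  by field; rewrite !sC0.
have dn : (1 - p) * rho * (Num.sqrt (n%:R * (N%:R - n%:R + 1)) *
      krawtchouk n.-1 p N x) =
    k * p * (if n is n'.+1 then (1 - p) / p * (N - n')%:R * P`_n' else 0).
  (* At n = 0 the root vanishes, so the value at [n.-1] = 0 contributes nothing. *)
  rewrite /k; case: (n) nN => [|n'] /= n'N; first by rewrite mul0r sqrtr0; ring.
  have -> : N%:R - n'.+1%:R + 1 = N%:R - n'%:R :> R by rewrite -natr1; ring.
  rewrite krawtchoukE ?(ltnW n'N) // -/rho -/P exprS.
  have [_ /(canRL (mulfK (sC0 _ n'N))) ->] := sqrt_bin_left R n'N.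
  by field; rewrite !sC0 ?(ltnW n'N) ?gt_eqF.
rewrite mulrDr dn up.
transitivity (k * p * (n.+1%:R * P`_n.+1 +
    (if n is n'.+1 then (1 - p) / p * (N - n')%:R * P`_n' else 0))).
  rewrite [RHS]mulrDr; congr (_ + _).
  transitivity ((1 - p) * rho ^+ 2 * k * (n.+1%:R * P`_n.+1)); first by ring.
  by rewrite rho2; field; rewrite gt_eqF.
rewrite krawtchouk_poly_recurrence // krawtchoukE //.
by rewrite -/rho -/k; field; rewrite gt_eqF.
Qed.

(** * Calculus on the half-line, for the conservation of s^2 + r^2 *)

Section HalfLineDerivative.
Local Open Scope classical_set_scope.
Variable R : realType.
Implicit Types (f g : R -> R) (t l m : R).
Local Notation filt t := (within (@halfline R) t^').

Lemma is_deriv_halfline_cvg f t l : is_deriv_halfline f t l ->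
  f x @[x --> filt t] --> f t.
Proof.
move=> fl.
have x0 : x - t @[x --> filt t] --> (t - t : R).
  apply: (@cvg_within_filter _ _ _ t^').
  apply: (@cvg_within_filter _ _ _ (nbhs t)).
  by apply: cvgB => //; exact: cvg_cst.
have : (f x - f t) / (x - t) * (x - t) + f t @[x --> filt t] -->
    l * (t - t) + f t by apply: cvgD; [exact: cvgM | exact: cvg_cst].
rewrite subrr mulr0 add0r; apply: cvg_trans; apply: near_eq_cvg.
near=> x.
rewrite divfK ?subrK // subr_eq0.
near: x; apply: cvg_within; exact: (@nbhs_dnbhs_neq R t).
Unshelve. all: by end_near. Qed.

Lemma is_deriv_halflineD f g t l m :
  is_deriv_halfline f t l -> is_deriv_halfline g t m ->
  is_deriv_halfline (f \+ g) t (l + m).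
Proof.
move=> fl gm; have : (f x - f t) / (x - t) + (g x - g t) / (x - t)
    @[x --> filt t] --> l + m by exact: cvgD.
apply: cvg_trans; apply: near_eq_cvg.
by apply: nearW => x /=; rewrite -mulrDl; congr (_ / _); ring.
Qed.

Lemma is_deriv_halfline_sqr f t l : is_deriv_halfline f t l ->
  is_deriv_halfline (fun x => f x ^+ 2) t (l * (f t + f t)).
Proof.
move=> fl; have fc := is_deriv_halfline_cvg fl.
have : (f x - f t) / (x - t) * (f x + f t) @[x --> filt t] -->
    l * (f t + f t) by apply: cvgM => //; apply: cvgD => //; exact: cvg_cst.
apply: cvg_trans; apply: near_eq_cvg; apply: nearW => x /=.
by rewrite subr_sqr mulrAC.
Qed.

(** A point t > 0 has a neighbourhood inside the half-line, so the restricted limit is the usual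
    two-sided one. *)
Lemma is_deriv_halfline_interior f t l : 0 < t -> is_deriv_halfline f t l ->
  is_derive t 1 f l.
Proof.
move=> t0 fl.
have ft : h^-1 *: ((f \o shift t) (h *: 1) - f t) @[h --> 0^'] --> l.
  move=> A /fl nA.
  have /nbhs0P {}nA : \forall x \near nbhs t, x != t -> halfline x ->
    A ((f x - f t) / (x - t)) by exact: nA.
  have /nbhs0P t_pos : \forall x \near nbhs t, 0 < x by exact: lt_nbhsr.
  suff : \forall h \near nbhs (0 : R), h != 0 ->
    A (h^-1 *: ((f \o shift t) (h *: 1) - f t)) by [].
  near=> h => h0.
  have /= th0 : 0 < t + h by near: h; exact: t_pos.
  have hA : t + h != t -> halfline (t + h) -> A ((f (t + h) - f t) / (t + h - t)).
    by near: h; exact: nA.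
  rewrite /= scaler1 [h + t]addrC; move: hA.
  rewrite -subr_eq0 [t + h - t]addrAC subrr add0r [_ / h]mulrC; apply=> //.
  by rewrite /halfline /= in_itv /= andbT ltW.
apply: DeriveDef; first by apply/cvg_ex; exists l.
exact: cvg_lim.
Unshelve. all: by end_near. Qed.

(** Mean value theorem on [0, t]: the derivative is two-sided inside, and the one-sided derivative
    at 0 gives continuity from the right there. *)
Lemma deriv_halfline0_constant f :
  (forall t, 0 <= t -> is_deriv_halfline f t 0) ->
  forall t, 0 <= t -> f t = f 0.
Proof.
move=> f0 t; rewrite le_eqVlt => /predU1P[<- //|t0].
have fin (x : R) : 0 < x -> is_derive x 1 f 0.
  by move=> x0; apply: is_deriv_halfline_interior => //; apply: f0; exact: ltW.
have fc0 : f x @[x --> 0^'+] --> f 0.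
  move=> A /(is_deriv_halfline_cvg (f0 0 (lexx 0))) nA.
  have {}nA : \forall x \near nbhs 0, x != 0 -> halfline x -> A (f x) by exact: nA.
  suff : \forall x \near nbhs 0, 0 < x -> A (f x) by [].
  apply: filterS nA => x /= Ax x0; apply: Ax; first by rewrite gt_eqF.
  by rewrite /halfline /= in_itv /= andbT ltW.
have [||c _] := @MVT R f (fun=> 0) 0 t t0.
- by move=> x; rewrite in_itv /= => /andP[x0 _]; exact: fin.
- apply/continuous_within_itvP => //; split=> //.
    move=> x; rewrite in_itv /= => /andP[x0 _].
    by apply/differentiable_continuous/derivable1_diffP; case: (fin x x0).
  apply: cvg_at_left_filter.
  by apply/differentiable_continuous/derivable1_diffP; case: (fin t t0).
by rewrite mul0r => /subr0_eq.
Qed.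

End HalfLineDerivative.

(** * The Krawtchouk transform: unitarity and intertwining *)

(** Orthonormality says A B = 1 for square matrices, whence B A = 1. *)
Lemma krawtchouk_dual_orthonormal (R : realType) (p : R) N (x y : 'I_N.+1) :
    0 < p < 1 ->
  \sum_(n < N.+1)
    krawtchouk n p N x * (krawtchouk n p N y * krawtchouk_weight p N y) =
  (x == y)%:R.
Proof.
move=> p01.
pose A : 'M[R]_N.+1 := \matrix_(n, x) krawtchouk n p N x.
pose B : 'M[R]_N.+1 :=
  \matrix_(x, n) (krawtchouk n p N x * krawtchouk_weight p N x).
have /mulmx1C/matrixP/(_ y x) : A *m B = 1%:M.
  apply/matrixP => n m; rewrite !mxE -val_eqE /=.
  rewrite -(krawtchouk_orthonormal p01 (leq_ord n) (leq_ord m)).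
  by apply: eq_bigr => z _; rewrite !mxE mulrA.
rewrite !mxE eq_sym => <-; apply: eq_bigr => n _.
by rewrite !mxE mulrC.
Qed.

HB.instance Definition _ (R : realType) (N : nat) (p : R) :=
  GRing.isLinear.Build R[i] (ell2 R N) {ffun 'I_N.+1 -> R[i]} *:%R
    (@krawtchouk_map R N p) (lin_ext_is_linear _).

Section KrawtchoukTransform.
Local Open Scope complex_scope.
Local Open Scope ring_scope.
Variables (R : realType) (N : nat) (p : R).
Hypothesis p01 : 0 < p < 1.
Local Notation U := (@krawtchouk_map R N p).
Local Notation W := (fun x : 'I_N.+1 => krawtchouk_weight p N x).

Lemma krawtchouk_map_val (v : ell2 R N) (x : 'I_N.+1) :
  U v x = \sum_(n < N.+1) v n * (krawtchouk n p N x)%:C.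
Proof.
rewrite /krawtchouk_map /lin_ext sum_ffunE.
by apply: eq_bigr => n _; rewrite !ffunE.
Qed.

(** The index k may exceed N because E sends e_N to the zero vector [basis_vec R N N.+1]. *)
Lemma krawtchouk_map_basis k (x : 'I_N.+1) :
  U (basis_vec R N k) x = if (k <= N)%N then (krawtchouk k p N x)%:C else 0.
Proof.
case: leqP => kN.
  rewrite -[k]/(nat_of_ord (Ordinal (kN : (k < N.+1)%N))) /krawtchouk_map.
  by rewrite lin_ext_basis ffunE.
rewrite krawtchouk_map_val big1 // => n _; rewrite ffunE ltn_eqF ?mul0r //.
exact: leq_trans (ltn_ord n) kN.
Qed.

(** The transposed kernel times the weight of the target space; the kernel is real, so no
    conjugation appears. *)
Definition krawtchouk_adjoint (g : {ffun 'I_N.+1 -> R[i]}) : ell2 R N :=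
  [ffun n : 'I_N.+1 => \sum_(x < N.+1)
    (krawtchouk n p N x * krawtchouk_weight p N x)%:C * g x].
Local Notation Us := krawtchouk_adjoint.

Lemma krawtchouk_map_adjoint : adjoint_map (@unit_weight R N) W U Us.
Proof.
move=> f g; rewrite /wdot.
under eq_bigr => x _ do rewrite krawtchouk_map_val -mulrA mulr_suml.
rewrite exchange_big; apply: eq_bigr => n _.
rewrite /unit_weight mulr1 ffunE rmorph_sum mulr_sumr; apply: eq_bigr => x _ /=.
rewrite [X in _ = _ * X]rmorphM.
rewrite [X in _ = _ * (X * _)](conjc_real _ : (_%:C)^* = _%:C) [in RHS]rmorphM.
by rewrite -!mulrA [_ * (g x)^*]mulrC.
Qed.

Lemma krawtchouk_mapK : cancel U Us.
Proof.
move=> v; apply/ffunP => n; rewrite ffunE.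
under eq_bigr => x _ do rewrite krawtchouk_map_val mulr_sumr.
rewrite exchange_big (bigD1 n) //= [X in _ + X]big1 => [|m mn].
  rewrite addr0; under eq_bigr => x _ do rewrite mulrCA -rmorphM mulrAC.
  rewrite -mulr_sumr -rmorph_sum krawtchouk_orthonormal ?leq_ord //.
  by rewrite eqxx rmorph1 mulr1.
under eq_bigr => x _ do rewrite mulrCA -rmorphM mulrAC.
rewrite -mulr_sumr -rmorph_sum krawtchouk_orthonormal ?leq_ord //.
by rewrite val_eqE eq_sym (negPf mn) rmorph0 mulr0.
Qed.

Lemma krawtchouk_adjointK : cancel Us U.
Proof.
move=> g; apply/ffunP => x; rewrite krawtchouk_map_val.
under eq_bigr => n _ do rewrite ffunE mulr_suml.
rewrite exchange_big (bigD1 x) //= [X in _ + X]big1 => [|y yx].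
  rewrite addr0.
  under eq_bigr => n _ do rewrite mulrAC -rmorphM mulrC [in X in _ * X]mulrC.
  rewrite -mulr_sumr -rmorph_sum krawtchouk_dual_orthonormal //.
  by rewrite eqxx rmorph1 mulr1.
under eq_bigr => n _ do rewrite mulrAC -rmorphM mulrC [in X in _ * X]mulrC.
rewrite -mulr_sumr -rmorph_sum krawtchouk_dual_orthonormal //.
by rewrite eq_sym (negPf yx) rmorph0 mulr0.
Qed.

Lemma krawtchouk_map_unitary : unitary_map (@unit_weight R N) W U.
Proof.
split; first exact: lin_ext_is_linear.
  by exists Us; [exact: krawtchouk_mapK | exact: krawtchouk_adjointK].
by move=> f g; rewrite krawtchouk_map_adjoint krawtchouk_mapK.
Qed.

Lemma krawtchouk_map_piH v (x : 'I_N.+1) :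
  U (piH v) x =
  \sum_(n < N.+1) v n * (2 * (n%:R - spin R N) * krawtchouk n p N x)%:C.
Proof.
rewrite /piH /lin_ext linear_sum sum_ffunE; apply: eq_bigr => n _.
rewrite !linearZ !ffunE krawtchouk_map_basis leq_ord.
by rewrite [in RHS]rmorphM.
Qed.

Lemma krawtchouk_map_piE v (x : 'I_N.+1) :
  U (Defs.piE v) x = \sum_(n < N.+1) v n *
    (Num.sqrt (n.+1%:R * (N%:R - n%:R)) * krawtchouk n.+1 p N x)%:C.
Proof.
rewrite /Defs.piE /lin_ext linear_sum sum_ffunE; apply: eq_bigr => n _.
rewrite !linearZ !ffunE krawtchouk_map_basis.
have -> : 2 * spin R N = N%:R by rewrite /spin; field.
(* For n = N the image is zero on the left, and on the right the root vanishes. *)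
rewrite [in RHS]rmorphM; case: ltnP => // nN.
have -> : N%:R = n%:R :> R.
  by congr _%:R; apply/eqP; rewrite eqn_leq nN leq_ord.
by rewrite subrr mulr0 sqrtr0 rmorph0 mul0r scale0r scaler0 mulr0.
Qed.

Lemma krawtchouk_map_piF v (x : 'I_N.+1) :
  U (piF v) x = \sum_(n < N.+1) v n *
    (Num.sqrt (n%:R * (N%:R - n%:R + 1)) * krawtchouk n.-1 p N x)%:C.
Proof.
rewrite /piF /lin_ext linear_sum sum_ffunE; apply: eq_bigr => n _.
rewrite !linearZ !ffunE krawtchouk_map_basis.
have -> : 2 * spin R N = N%:R by rewrite /spin; field.
by rewrite [in RHS]rmorphM (leq_trans (leq_pred _)) ?leq_ord.
Qed.

(** Comparing the coefficients of v n, the recurrence leaves 2C((2p - 1)(n - N/2) + pN - x - (2p -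
    1)n) = 2C(N/2 - x), in which n cancels. *)
Lemma krawtchouk_map_lax (s r : R -> R) (t C : R) v :
    s t = C * (2 * p - 1) -> r t = 2 * C * Num.sqrt (p * (1 - p)) ->
  U (pi_rep (laxL s r t) v) =
  mulop (fun x : 'I_N.+1 => 2 * C * (spin R N - x%:R)) (U v).
Proof.
move=> st rt; apply/ffunP => x.
rewrite [RHS]ffunE.
have [X00 X01 X10] : [/\ laxL s r t 0 0 = (s t)%:C, laxL s r t 0 1 = (r t)%:C &
    laxL s r t 1 0 = (r t)%:C].
  by rewrite /laxL /sl2H /sl2E /sl2F !mxE /=; split;
     rewrite !(subr0, addr0, add0r, mulr1, mulr0).
have UD a b c f g h F G H : U f x = F -> U g x = G -> U h x = H ->
    U (a *: f + b *: g + c *: h) x = a * F + b * G + c * H.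
  move=> <- <- <-.
  rewrite !krawtchouk_map_val !mulr_sumr -!big_split; apply: eq_bigr => n _.
  by rewrite !ffunE /= !mulrDl !mulrA.
rewrite /pi_rep X00 X01 X10 (UD _ _ _ _ _ _ _ _ _ (krawtchouk_map_piH v x)
  (krawtchouk_map_piE v x) (krawtchouk_map_piF v x)).
rewrite krawtchouk_map_val !mulr_sumr -!big_split; apply: eq_bigr => n _ /=.
rewrite ![(_ : R[i]) * (v n * _)]mulrCA -!mulrDr; congr (_ * _).
rewrite -!rmorphM -!rmorphD -addrA -mulrDr; congr (_%:C).
rewrite st rt -[X in _ + X]mulrA krawtchouk_recurrence ?leq_ord // /spin.
by move: (krawtchouk n p N x) => k; field.
Qed.

End KrawtchoukTransform.

(** * The conserved quantity C, the parameter p, and the conclusion *)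

Theorem theorem3p2 (R : realType) (r s u : R -> R) (N : nat)
  (r_C1 : C1_halfline r) (s_C1 : C1_halfline s) (u_C0 : continuous_halfline u)
  (s_ode : forall t : R, 0 <= t -> is_deriv_halfline s t (2 * u t * r t))
  (r_ode : forall t : R, 0 <= t -> is_deriv_halfline r t (- (2 * u t * s t)))
  (sgn_ur : forall t : R, 0 < t -> Num.sg (u t) = Num.sg (r t))
  (r_gt0 : forall t : R, 0 <= t -> 0 < r t)
  (s_gt0 : forall t : R, 0 <= t -> 0 < s t) :
  exists C : R,
    (forall t : R, 0 <= t -> Num.sqrt (s t ^+ 2 + r t ^+ 2) = C) /\
    forall t : R, 0 < t ->
      let p := 1 / 2 + s t / (2 * C) in
      let W := fun x : 'I_N.+1 => krawtchouk_weight p N x in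
      let U := @krawtchouk_map R N p in
      unitary_map (@unit_weight R N) W U /\
      exists Us : {ffun 'I_N.+1 -> R[i]} -> ell2 R N,
        adjoint_map (@unit_weight R N) W U Us /\
        U \o pi_rep (laxL s r t) \o Us =
          mulop (fun x : 'I_N.+1 => 2 * C * (spin R N - x%:R)).
Proof.
have sr_cst t : 0 <= t -> s t ^+ 2 + r t ^+ 2 = s 0 ^+ 2 + r 0 ^+ 2.
  pose f := (fun x => s x ^+ 2) \+ (fun x => r x ^+ 2).
  apply: (@deriv_halfline0_constant _ f) => x x0.
  have := is_deriv_halflineD (is_deriv_halfline_sqr (s_ode x x0))
    (is_deriv_halfline_sqr (r_ode x x0)).
  by rewrite (_ : _ + _ = 0) //; ring.
pose C := Num.sqrt (s 0 ^+ 2 + r 0 ^+ 2).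
exists C; split=> [t t0|t t0]; first by rewrite sr_cst.
have st := s_gt0 _ (ltW t0); have rt := r_gt0 _ (ltW t0).
have CE : C ^+ 2 = s t ^+ 2 + r t ^+ 2.
  by rewrite sqr_sqrtr ?addr_ge0 ?sqr_ge0 // sr_cst // ltW.
have C0 : 0 < C by rewrite sqrtr_gt0 -(sr_cst t) ?ltW // addr_gt0 ?exprn_gt0.
(* Strictness comes from r > 0. Together with s > 0 it gives 0 < C + s < 2C, that is 0 < p < 1. *)
have sC : s t < C.
  by rewrite -(ltr_pXn2r (ltn0Sn 1)) ?nnegrE ?ltW // CE ltrDl exprn_gt0.
move=> p W U.
have pE : 2 * C * p = C + s t by rewrite /p; field; rewrite gt_eqF.
have p01 : 0 < p < 1.
  have C2 : 0 < 2 * C by rewrite mulr_gt0.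
  by rewrite -(ltr_pM2l C2) -[p < 1](ltr_pM2l C2) pE; apply/andP; split; lra.
have sE : s t = C * (2 * p - 1) by rewrite mulrBr mulrCA mulrA pE; ring.
have rE : r t = 2 * C * Num.sqrt (p * (1 - p)).
  (* Positivity of r selects the positive root of r^2 = C^2 - s^2 = 4 C^2 p(1 - p). *)
  rewrite -[LHS](gtr0_norm rt) -sqrtr_sqr.
  have -> : r t ^+ 2 = (2 * C) ^+ 2 * (p * (1 - p)).
    by rewrite -[LHS](addKr (s t ^+ 2)) -CE sE; ring.
  by rewrite sqrtrM ?sqr_ge0 // sqrtr_sqr gtr0_norm // mulr_gt0.
split; first exact: krawtchouk_map_unitary.
exists (@krawtchouk_adjoint R N p); split; first exact: krawtchouk_map_adjoint.
apply/funext => g /=.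
(* The intertwining relation is applied to U* g, and then U U* = 1. *)
by rewrite /U (krawtchouk_map_lax p01 _ sE rE) krawtchouk_adjointK.
Qed.
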